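(* Let $n\ge1$ and $S=\{(a_i,b_i)\}_{i=1}^{n+1}\subset\mathbb R_{>0}\times\mathbb R_{\ge0}$ with $0<a_1<\cdots<a_{n+1}$. Assume $f$ is the minimal polynomial of $S$, that $S_n:=\{(a_i,b_i)\}_{i=1}^n$ has a minimal polynomial $f_0\in\mathbb R_{\ge0}[X]$, that $\mathfrak d(f_0)=n$, and that $f_0\neq f$. Let $s=\mathrm{Sign}(f_0)$ and write $\operatorname{supp}(\lfloor s\rfloor)=\{d_1>\cdots>d_n\}$ (it has exactly $n$ elements). Let $M$ be the $(n+1)\times n$ matrix whose $l$-th row is $(a_l^{d_n},a_l^{d_{n-1}},\dots,a_l^{d_1})$, and $\mathbf b=(b_1,\dots,b_{n+1})^t$. For $j\in[n]$ let $\Delta_j$ be the matrix obtained from $M$ by replacing its $(n-j+1)$-th column (the column with entries $a_l^{d_j}$) by $\mathbf b$; for $i\in[n+1]$ let $\Delta_j^{(i)}$ be the $n\times n$ matrix obtained from $\Delta_j$ by deleting its $i$-th row, and $D_j^{(i)}=\det\Delta_j^{(i)}$. Then: (1) $D_j^{(i)}>0$ for every odd $j\in[n]$ and every $i\in[n+1]$. (2) If $k$ is the least natural number such that $k>d_1$ and $k\ge \dfrac{\log\bigl(nD_j^{(i)}/D_j^{(n+1)}\bigr)}{\log(a_{n+1}/a_i)}$ for every odd $j\in[n]$ and every $i\in[n]$, then $\deg(f)\le k$.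
   Context: $\mathbb R_{\ge0}[X]$: real polynomials with nonnegative coefficients; interpolating means $f(a_i)=b_i$. $\omega=\{0,1,\dots\}$, $[m]=\{1,\dots,m\}$. A finite sign sequence is $s\in\{-,0,+\}^\omega$ with finitely many nonzero entries; $\mathscr S$ their set, $\operatorname{supp}(s)=\{i:s_i\ne0\}$, $\mathscr S_+=\mathscr S\cap\{0,+\}^\omega$; $\mathrm{Sign}(f)$ is the sequence of signs of coefficients of $f$. $\mathrm{SC}(t)$ = number of pairs $i<j$ with $\{t_i,t_j\}=\{-,+\}$ and $t_k=0$ for $i<k<j$. $\mathfrak d(s)=\max\{\mathrm{SC}(t):t\in\mathscr S,\ t_i\in\{-,0,s_i\}\ \forall i\}$ for $s\in\mathscr S_+$, $\mathfrak d(f)=\mathfrak d(\mathrm{Sign} f)$. For a set of $m$ points with distinct positive first coordinates, $f\in\mathbb R_{\ge0}[X]$ interpolating it is its minimal polynomial if $\mathfrak d(f)\le m$. Interval decomposition of $s\in\mathscr S_+$: $\operatorname{supp}(s)=X_0\amalg\cdots\amalg X_k$ into intervals of $\omega$ with $0\in X_0$ if $0\in\operatorname{supp}(s)$ else $X_0=\emptyset$, $X_i\ne\emptyset$ for $i\ge1$, $\min X_i-\max X_{i-1}\ge2$ ($\max\emptyset=-\infty$). $\lfloor s\rfloor\in\mathscr S_+$ has support $X_0\amalg\lfloor X_1\rfloor\amalg\cdots\amalg\lfloor X_k\rfloor$, where $\lfloor X_i\rfloor=\{\min X_i-1\}\amalg X_i$ if $\#X_i$ is odd and $X_i$ otherwise.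 *)

(* Defs.v *)
From HB Require Import structures.
From mathcomp Require Import all_boot all_order all_algebra.
From mathcomp Require Import all_classical all_reals exp.
Set Implicit Arguments. Unset Strict Implicit. Unset Printing Implicit Defensive.
Import Order.TTheory GRing.Theory Num.Theory.
Local Open Scope ring_scope.

(* A finite sign sequence is encoded as a [seq int] with entries in {-1,0,1};
   entries beyond the size of the list are 0 (so finite support is automatic).
   [-] = -1, [0] = 0, [+] = 1. *)

Definition Sign (R : numDomainType) (f : {poly R}) : seq int :=
  map (fun c => sgz c) (polyseq f).

Definition SC (t : seq int) : nat :=
  \sum_(i < size t) \sum_(j < size t)
     nat_of_bool ((i < j)%N && ((nth 0 t i * nth 0 t j)%R == (-1)%R :> int)
       && all (fun k => nth 0 t k == 0 :> int) (iota i.+1 (j - i.+1)%N)).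

Definition compat (s t : seq int) : bool :=
  all (fun i => t`_i \in [:: -1; 0; s`_i]) (iota 0 (size t)).

(* dfrak(s) <= m, i.e. max{SC t : t compatible with s} <= m. *)
Definition dfrak_le (s : seq int) (m : nat) : Prop :=
  forall t : seq int, compat s t -> (SC t <= m)%N.

Definition dfrak_eq (s : seq int) (m : nat) : Prop :=
  dfrak_le s m /\ exists t : seq int, compat s t /\ SC t = m.

Definition nonneg_poly (R : realDomainType) (f : {poly R}) : Prop :=
  forall i : nat, 0 <= f`_i.

Definition is_minpoly (R : realDomainType) (m : nat) (a b : nat -> R)
    (f : {poly R}) : Prop :=
  [/\ nonneg_poly f,
      (forall i : nat, (1 <= i <= m)%N -> f.[a i] = b i)
    & dfrak_le (Sign f) m].

Definition run_len (s : seq int) (m : nat) : nat := find (pred1 0) (drop m s).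

(* i in supp(floor s): either i in supp(s), or i = min X - 1 for an interval X
   of the interval decomposition with min X >= 1 and #X odd.  (The intervals
   X_1..X_k are exactly the maximal runs of supp(s) not containing 0.) *)
Definition in_floor (s : seq int) (i : nat) : bool :=
  (s`_i != 0) || [&& s`_i == 0, s`_(i.+1) != 0 & odd (run_len s i.+1)].

(* supp(floor s), in increasing order (all elements are < size s). *)
Definition floor_supp (s : seq int) : seq nat :=
  [seq i <- iota 0 (size s) | in_floor s i].

Definition dseq (s : seq int) (j : nat) : nat := nth 0%N (rev (floor_supp s)) j.-1.

(* The (n+1) x n matrix M: row l (1-based l = r+1) is
   (a_l^{d_n}, a_l^{d_{n-1}}, ..., a_l^{d_1}); 0-based column c has d_{n-c}. *)
Definition Mmat (R : pzRingType) (n : nat) (a : nat -> R) (d : nat -> nat)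
  : 'M[R]_(n.+1, n) := \matrix_(r < n.+1, c < n) a r.+1 ^+ d (n - c)%N.

(* Delta_j: replace the (n-j+1)-th column (1-based), i.e. 0-based column n-j,
   by b = (b_1,...,b_{n+1})^t. *)
Definition Delta (R : pzRingType) (n : nat) (a b : nat -> R) (d : nat -> nat)
  (j : nat) : 'M[R]_(n.+1, n) :=
  \matrix_(r < n.+1, c < n) (if (c == (n - j)%N :> nat) then b r.+1
                              else Mmat n a d r c).

Definition Dji (R : comRingType) (n : nat) (a b : nat -> R) (d : nat -> nat)
  (j i : nat) : R :=
  \det (row' (inord i.-1 : 'I_n.+1) (Delta n a b d j)).

(* Main.v *)
Require Import Defs.
From HB Require Import structures.
From mathcomp Require Import all_boot all_order all_algebra.
From mathcomp Require Import all_classical all_reals exp.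
From mathcomp Require Import zify ring lra.
From mathcomp Require polyrcf.
Import Order.TTheory GRing.Theory Num.Theory.
Local Open Scope ring_scope.

(** By Descartes' rule of signs, two nonnegative polynomials agreeing at [m]
    positive points, one of them with [dfrak <= m], are compared at infinity by
    the sign of the leading coefficient of their difference. Applied to [f0]
    and [f], this gives [b_(n+1) = f0(a_(n+1)) + delta] with [delta > 0].
    Since [supp (floor s)] has [dfrak s = n] elements, [f0] is a combination of
    the [n] monomials [X^(d_j)], with positive coefficients at odd [j] (the
    elements added by the floor operation have even rank from the top). Hence
    [D_j^(i)] is a positive combination of generalized Vandermonde
    determinants, which are positive. For (2), the interpolant [h] of all the
    points supported on [d_1, .., d_n, k] has nonnegative coefficients: those
    at [d_j] with [j] even and at [k] only increase from those of [f0] and [0],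
    while for [j] odd the expansion along the column of [X^k] has numerator
    [\sum_i +- a_i^k D_j^(i)], dominated by its term [i = n+1] by the choice of
    [k]. Comparing [f] with [h] gives [deg f <= deg h <= k]. *)

(** * Sign variations of a list and multiplication by a linear factor *)

Section SignVariations.
Variable R : realDomainType.
Implicit Types (x y z : R) (l : seq R).

Fixpoint first_nonzero l : R :=
  if l is x :: l' then if x == 0 then first_nonzero l' else x else 0.

(** Recursive form of [SC]: each entry is compared with the next nonzero one, and zeros contribute
    nothing because the product vanishes. *)
Fixpoint var l : nat :=
  if l is x :: l' then ((x * first_nonzero l' < 0)%R + var l')%N else 0%N.

Lemma first_nonzero_eq0 l : (first_nonzero l == 0) = all (pred1 0) l.
Proof. by elim: l => [|x l IH] /=; rewrite ?eqxx //; case: (eqVneq x 0) => // /negbTE. Qed.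

Lemma mul_sign_eq x y z : 0 < x * y -> (x * z < 0) = (y * z < 0).
Proof.
move=> xy; have y0 : y != 0 by apply: contraTneq xy => ->; rewrite mulr0 ltxx.
have y2 : 0 < y ^+ 2 by rewrite exprn_even_gt0.
by rewrite -(pmulr_rlt0 (y * z) xy) -(pmulr_rlt0 (x * z) y2); congr (_ < _); ring.
Qed.

Lemma var_cons_sign x y l : 0 < x * y -> var (x :: l) = var (y :: l).
Proof.
by move=> xy; rewrite /= (mul_sign_eq x y).
Qed.

Lemma var_consW x l : (var l <= var (x :: l))%N.
Proof. exact: leq_addl. Qed.

Lemma var_cons_le x y l : (var (x :: l) <= (var (y :: l)).+1)%N.
Proof. by rewrite /=; case: (_ < 0); case: (_ < 0); lia. Qed.

Lemma var_cons_opp x y l : x * y < 0 -> var (x :: y :: l) = (var (y :: l)).+1.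
Proof.
move=> xy; rewrite /= ifN ?xy //.
by apply: contraTneq xy => ->; rewrite mulr0 ltxx.
Qed.

(** If [x] and the next nonzero entry have opposite signs, a nonzero [y] between them differs in
    sign from one of the two. *)
Lemma var_insert x y l : (var (x :: l) <= var (x :: y :: l))%N.
Proof.
rewrite /=; case: eqVneq => [->|y0]; first by rewrite mul0r ltxx.
rewrite addnA leq_add2r; set z := first_nonzero l.
case: (ltrP (x * z) 0) => //= xz; case: (ltrP (x * y) 0) => //= xy.
have x0 : x != 0 by apply: contraTneq xz => ->; rewrite mul0r ltxx.
by rewrite -(mul_sign_eq x) ?xz // lt_neqAle xy eq_sym mulf_neq0.
Qed.

Lemma first_nonzero_rcons l y :
  first_nonzero l != 0 -> first_nonzero (rcons l y) = first_nonzero l.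
Proof.
elim: l => [|x l IH] /=; first by rewrite eqxx.
by case: (x =P 0) => // _; exact: IH.
Qed.

Lemma var_rcons l y : last 0 l != 0 ->
  var (rcons l y) = ((last 0 l * y < 0)%R + var l)%N.
Proof.
elim: l => [|x [|z l] IH]; first by rewrite eqxx.
  by move=> _ /=; case: eqVneq => [->|]; rewrite ?mulr0 ltxx !addn0.
move=> hl; have {}IH := IH hl.
have nz : first_nonzero (z :: l) != 0.
  rewrite first_nonzero_eq0; apply: contra hl => /allP h.
  by have := h _ (mem_last z l).
rewrite rcons_cons -[LHS]/((x * first_nonzero (rcons (z :: l) y) < 0)%R + var (rcons (z :: l) y))%N.
by rewrite first_nonzero_rcons // IH addnCA.
Qed.

Lemma var_le_count l : (var l <= (count (predC1 0%R) l).-1)%N.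
Proof.
elim: l => [//|x l IH] /=.
case: (ltrP (x * first_nonzero l) 0) => h; last by move: IH; case: (x != 0) => /=; lia.
have x0 : x != 0 by apply: contraTneq h => ->; rewrite mul0r ltxx.
have : first_nonzero l != 0 by apply: contraTneq h => ->; rewrite mulr0 ltxx.
rewrite first_nonzero_eq0 -has_predC has_count => h2.
have e : count (predC (pred1 0%R)) l = count (predC1 0%R) l by [].
by rewrite x0 /=; move: IH h2; rewrite e; lia.
Qed.

(* Coefficients of [(c + q * 'X) - a * q], where [l] lists those of [q]. *)
Fixpoint mulXsub (a c : R) l :=
  if l is h :: l' then (c - a * h) :: mulXsub a h l' else [:: c].

(* The coefficient [c] of [q] produces consecutive coefficients of sign [- c]
   and [c - a * h] in [('X - a) * q], [h] being the coefficient of [q] after [c].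
   The second claim continues the case [h = 0]. *)
Lemma var_mulXsub_aux a m : 0 < a -> forall l, (size l <= m)%N ->
  (forall c, c != 0 -> (var (c :: l) < var ((- c) :: mulXsub a c l))%N) /\
  (forall c, c != 0 -> (var (c :: l) <= var (c :: mulXsub a 0 l))%N).
Proof.
move=> a0; elim: m => [|m IH] [|h l] //= hs.
- split=> c c0 /=.
    by rewrite (negbTE c0) mulr0 ltxx; have -> : - c * c < 0 by nra.
  by rewrite eqxx !mulr0 ltxx.
- split=> c c0 /=.
    by rewrite (negbTE c0) mulr0 ltxx; have -> : - c * c < 0 by nra.
  by rewrite eqxx !mulr0 ltxx.
have [Q Rr] := IH l hs.
split=> c c0; rewrite -/(var (h :: l)) -/(var (c :: h :: l)).
- rewrite -[X in (_ < X)%N]/(var (- c :: c - a * h :: mulXsub a h l)).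
  have [h0|h0] := eqVneq h 0.
    have nc : - c * c < 0 by nra.
    rewrite h0 mulr0 subr0 (var_cons_opp _ _ _ nc) ltnS.
    apply: leq_trans (Rr c c0).
    by rewrite /= eqxx mul0r ltxx.
  have [ch|ch] := ltrP (c * h) 0.
    have h1 : - c * (c - a * h) < 0.
      have : 0 < c ^+ 2 by rewrite exprn_even_gt0.
      by nra.
    have h2 : 0 < (c - a * h) * - h by nra.
    rewrite (var_cons_opp _ _ _ h1) (var_cons_opp _ _ _ ch) (var_cons_sign _ _ _ h2) ltnS.
    exact: Q.
  have ch' : 0 < c * h by rewrite lt_neqAle ch eq_sym mulf_neq0.
  have h1 : 0 < - c * - h by rewrite mulrNN.
  (* The sign of [c - a * h] is unknown here, so this entry is dropped, and [- c] is traded for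
     [- h], which has the same sign. *)
  apply: leq_trans (var_insert _ _ _).
  rewrite (var_cons_sign _ _ _ h1); apply: leq_trans (Q h h0).
  have -> : var (c :: h :: l) = var (h :: l) => //.
  by rewrite /= (negbTE h0) ltNge ch.
- rewrite sub0r -[X in (_ <= X)%N]/(var (c :: - (a * h) :: mulXsub a h l)).
  have [h0|h0] := eqVneq h 0.
    rewrite h0 mulr0 oppr0; apply: leq_trans (var_insert _ _ _).
    by apply: leq_trans (Rr c c0); rewrite /= eqxx mul0r ltxx.
  apply: leq_trans (leq_addl _ _); rewrite -/(var (_ :: _)).
  have h1 : 0 < - (a * h) * - h.
    have : 0 < h ^+ 2 by rewrite exprn_even_gt0.
    by nra.
  rewrite (var_cons_sign _ _ _ h1); apply: leq_trans (Q h h0).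
  (* The strict inequality of the first claim pays for a possible change from [c] to [h]. *)
  by rewrite /=; case: (_ < 0) => //; lia.
Qed.

(** Initial zeros are passed over; the first nonzero [h] opens the product with [- (a * h)], which
    has the sign of [- h] as in the first claim above. *)
Lemma var_mulXsub a l : 0 < a -> has (predC1 0%R) l ->
  (var l < var (mulXsub a 0 l))%N.
Proof.
move=> a0; elim: l => [//|h l IH].
have [-> hl|h0 _] := eqVneq h 0.
  rewrite /= mul0r ltxx mulr0 subr0 mul0r ltxx add0n.
  by apply: IH; move: hl; rewrite /= eqxx.
have h1 : 0 < - (a * h) * - h.
  have : 0 < h ^+ 2 by rewrite exprn_even_gt0.
  by nra.
rewrite -[X in (_ < X)%N]/(var (0 - a * h :: mulXsub a h l)) sub0r (var_cons_sign _ _ _ h1).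
by have [Q _] := var_mulXsub_aux a (size l) a0 l (leqnn _); exact: Q.
Qed.

End SignVariations.

(** * Descartes' rule of signs for distinct positive roots *)

Section Descartes.
Variable R : realDomainType.
Implicit Types (p q : {poly R}) (a x : R) (l : seq R).

Lemma size_mulXsub a c l : size (mulXsub R a c l) = (size l).+1.
Proof. by elim: l c => //= h l IH c; rewrite IH. Qed.

Lemma nth_mulXsub a c l i :
  (mulXsub R a c l)`_i = (if i is j.+1 then l`_j else c) - a * l`_i.
Proof.
elim: l c i => [|h l IH] c [|i] /=; rewrite ?nth_nil ?mulr0 ?subr0 ?IH //.
by case: i.
Qed.

Lemma polyseq_mulXsub q a :
  q != 0 -> polyseq (q * ('X - a%:P)) = mulXsub R a 0 q.
Proof.
move=> q0.
have sz : size (q * ('X - a%:P)) = (size q).+1.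
  by rewrite size_Mmonic ?monicXsubC // size_XsubC addnC.
apply: (@eq_from_nth _ 0) => [|i _]; first by rewrite size_mulXsub sz.
rewrite nth_mulXsub mulrBr coefB coefMX coefMC [in RHS]mulrC.
by case: i.
Qed.

Lemma has_nz_poly q : q != 0 -> has (predC1 0) q.
Proof.
move=> q0; apply/hasP; exists (lead_coef q); last by rewrite /= lead_coef_eq0.
by rewrite lead_coefE mem_nth // prednK ?lt0n ?size_poly_eq0.
Qed.

(** Dividing by ['X - x%:P] loses at least one variation, and the other listed roots remain roots of
    the quotient. *)
Lemma descartes p (rs : seq R) : p != 0 -> uniq rs ->
  all (fun x => (0 < x) && root p x) rs -> (size rs <= var R p)%N.
Proof.
elim: rs p => [//|x rs IH] p p0 /= /andP[xrs urs] /andP[/andP[x0 /factor_theorem[q e]] hrs].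
have q0 : q != 0 by apply: contraNneq p0 => q0; rewrite e q0 mul0r.
rewrite e polyseq_mulXsub //.
apply: leq_ltn_trans (var_mulXsub R x q x0 (has_nz_poly _ q0)).
apply: IH => //; apply/allP => y yrs; have /andP[y0 hy] := allP hrs y yrs.
rewrite y0 /=; move: hy; rewrite e rootM root_XsubC => /orP[//|/eqP yx].
by rewrite -yx yrs in xrs.
Qed.

End Descartes.

(** * Agreement of [SC] with the recursive count [var] *)

Lemma SC_cons (x : int) (t : seq int) :
  SC (x :: t) = ((x * first_nonzero _ t == -1)%R + SC t)%N.
Proof.
rewrite /SC /= big_ord_recl /=; congr (_ + _)%N.
(* In the row of index 0 only the first nonzero entry of [t] can contribute. *)
- rewrite big_ord_recl /= add0n.
  under eq_bigr do rewrite /bump /= subn1 /= add0n.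
  elim: t => [|y t IH] /=; first by rewrite big_ord0 mulr0.
  rewrite big_ord_recl /= andbT.
  under eq_bigr => i _ do rewrite /bump /= add0n.
  have [y0|y0] := eqVneq y 0.
    rewrite y0 mulr0 add0n -IH; apply: eq_bigr => i _.
    congr (nat_of_bool (_ && _)).
    by rewrite (iotaDl 2 0) (iotaDl 1 0) !all_map.
  by rewrite big1 ?addn0 // => i _; rewrite andbF.
- apply: eq_bigr => i _; rewrite big_ord_recl /= add0n.
  apply: eq_bigr => j _; rewrite /bump /= !add0n !add1n ltnS subSS.
  congr (nat_of_bool (_ && _)).
  by rewrite (iotaDl 1) all_map.
Qed.

Lemma first_nonzero_sgz (R : realDomainType) (l : seq R) :
  first_nonzero _ (map (@sgz _) l) = sgz (first_nonzero R l).
Proof. by elim: l => [|x l IH] /=; rewrite ?sgz0 // sgz_eq0 IH; case: eqP. Qed.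

Lemma SC_sgz (R : realDomainType) (l : seq R) : SC (map (@sgz _) l) = var R l.
Proof.
elim: l => [|x l IH]; first by rewrite /SC /= big_ord0.
rewrite map_cons SC_cons IH first_nonzero_sgz -sgzM /=.
congr (nat_of_bool _ + _)%N.
by rewrite -sgz_cp0.
Qed.

(** * Comparison of nonnegative polynomials with common values *)

Section Comparison.
Variable R : realDomainType.
Implicit Types (f g p q : {poly R}).

Lemma nth_Sign f i : (Sign f)`_i = sgz f`_i.
Proof.
rewrite /Sign; case: (ltnP i (size f)) => h; first by rewrite (nth_map 0).
by rewrite !nth_default ?size_map ?sgz0.
Qed.

Lemma compatP (s t : seq int) :
  (forall i, [\/ t`_i = -1, t`_i = 0 | t`_i = s`_i]) -> compat s t.
Proof.
move=> h; apply/allP => i _; rewrite !inE.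
by case: (h i) => ->; rewrite eqxx ?orbT.
Qed.

(** A coefficient of [f - g] can be positive only where that of [f] is, and [-1] is allowed
    everywhere, even past the end. *)
Lemma compat_Sign_sub f g : nonneg_poly f -> nonneg_poly g ->
  compat (Sign f) (rcons (Sign (f - g)) (-1)).
Proof.
move=> hf hg; apply: compatP => i; rewrite nth_rcons.
case: ltnP => hi; last by case: eqP; [constructor 1 | constructor 2].
rewrite !nth_Sign coefB.
case: (ltrgtP f`_i g`_i) => h.
- by constructor 1; apply/eqP; rewrite sgz_cp0 subr_lt0.
- constructor 3; have f0 : 0 < f`_i by apply: le_lt_trans h.
  by rewrite (gtr0_sgz f0) gtr0_sgz ?subr_gt0.
- by constructor 2; rewrite h subrr sgz0.
Qed.

(* Appending [-1] to the sign sequence of [f - g] keeps it compatible with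
   [Sign f], and gains a sign change when the leading coefficient is positive. *)
Lemma common_values_bound f g m (rs : seq R) :
  nonneg_poly f -> nonneg_poly g -> dfrak_le (Sign f) m -> f != g ->
  uniq rs -> all (fun x => (0 < x) && (f.[x] == g.[x])) rs ->
  ((0 < lead_coef (f - g))%R + size rs <= m)%N.
Proof.
move=> hf hg hm fg urs hrs; have d0 : f - g != 0 by rewrite subr_eq0.
apply: leq_trans (hm _ (compat_Sign_sub _ _ hf hg)).
have -> : rcons (Sign (f - g)) (-1) = map (@sgz _) (rcons (f - g) (-1)).
  by rewrite map_rcons sgzN1.
rewrite SC_sgz var_rcons; last first.
  by rewrite -nth_last -lead_coefE lead_coef_eq0.
rewrite -nth_last -lead_coefE mulrN1 oppr_lt0 leq_add2l.
apply: descartes => //; apply/allP => x /(allP hrs) /andP[x0 hx].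
by rewrite x0 rootE hornerD hornerN subr_eq0.
Qed.

End Comparison.

(** * The floor operation and the maximal number of sign changes *)

Lemma floor_supp_cons x s : floor_supp (x :: s) =
  (if in_floor (x :: s) 0 then [:: 0%N] else [::]) ++ map succn (floor_supp s).
Proof.
rewrite /floor_supp /= (iotaDl 1 0) filter_map.
by case: (in_floor _ 0).
Qed.

Lemma run_len_cons x s :
  run_len (x :: s) 0 = if x == 0 then 0%N else (run_len s 0).+1.
Proof. by rewrite /run_len !drop0 /=; case: eqP. Qed.

(** A run of odd length is nonempty, which absorbs the test on the next entry. *)
Lemma in_floor0 x s : in_floor (x :: s) 0 = (x != 0) || odd (run_len s 0).
Proof.
rewrite /in_floor /=; case: eqP => //= _.
have -> : run_len (x :: s) 1 = run_len s 0 by rewrite /run_len drop0 /= drop0.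
case: s => [|y s] /=; first by [].
by rewrite run_len_cons; case: eqP.
Qed.

Lemma size_floor_supp_cons x s : size (floor_supp (x :: s)) =
  (((x != 0)%R || odd (run_len s 0)) + size (floor_supp s))%N.
Proof. by rewrite floor_supp_cons size_cat size_map in_floor0; case: ifP. Qed.

(* The sign of the lowest nonzero entry of a sequence attaining [dfrak s]. *)
Definition floor_sign (s : seq int) : int :=
  if odd (run_len s 0) then 1 else -1.

Lemma floor_sign_cons x s :
  floor_sign (x :: s) = if x == 0 then -1 else - floor_sign s.
Proof.
rewrite /floor_sign run_len_cons; case: eqP => //= _.
by case: odd; rewrite ?opprK.
Qed.

Definition sign01 (s : seq int) := all (fun x => x \in [:: 0; 1]) s.

Lemma compat_cons x s y t :
  compat (x :: s) (y :: t) = (y \in [:: -1; 0; x]) && compat s t.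
Proof. by rewrite /compat /= (iotaDl 1 0) all_map. Qed.

Lemma compat_nil t : compat [::] t -> all (fun x => x <= 0) t.
Proof.
elim: t => // y t IH; rewrite /compat /= (iotaDl 1 0) all_map => /andP[hy ht].
apply/andP; split; last by apply: IH; move: ht; rewrite /compat; apply: sub_all => i /=; rewrite !nth_nil.
by move: hy; rewrite !inE => /or3P[]/eqP->.
Qed.

Lemma var_le0 (R : realDomainType) (l : seq R) :
  all (fun x => x <= 0) l -> var R l = 0%N /\ first_nonzero R l <= 0.
Proof.
elim: l => [//|x l IH] /= /andP[x0 /IH[-> f0]]; rewrite addn0.
split; last by case: eqP.
by rewrite ltNge mulr_le0.
Qed.

Lemma compat_sgz {s t} : sign01 s -> compat s t -> map (@sgz _) t = t.
Proof.
elim: t s => // y t IH [|x s].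
  move=> _ h; have := compat_nil _ h => _.
  have {h} : all (fun x => x \in [:: -1; 0]) (y :: t).
    elim: {IH} (y :: t) h => // z u IH; rewrite /compat /= (iotaDl 1 0) all_map => /andP[hz hu].
    apply/andP; split; first by move: hz; rewrite !inE => /or3P[]/eqP->.
    by apply: IH; move: hu; rewrite /compat; apply: sub_all => i /=; rewrite !nth_nil.
  elim: (y :: t) => //= z u IH2 /andP[hz /IH2->]; congr cons.
  by move: hz; rewrite !inE => /orP[]/eqP->.
rewrite compat_cons => /= /andP[x01 hs] /andP[hy ht].
rewrite (IH s) //; congr cons.
by move: hy x01; rewrite !inE => /or3P[]/eqP-> // /orP[]/eqP->.
Qed.

(** Prefixing [floor_sign s] strengthens the bound enough for induction: if the first nonzero entry
    of [t] has the opposite sign, [t] itself misses the maximum. *)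
Lemma var_floor_ub s t : sign01 s -> compat s t ->
  (var _ (floor_sign s :: t) <= size (floor_supp s))%N.
Proof.
elim: s t => [|x s IH] t.
  move=> _ /compat_nil h.
  have [] : var _ (-1 :: t) = 0%N /\ first_nonzero _ (-1 :: t) <= 0 :> int.
    by apply: var_le0; rewrite /= h.
  by move=> ->.
case: t => [|y t] /=; first by move=> _ _; rewrite mulr0 ltxx.
rewrite compat_cons => /andP[x01 hs] /andP[hy ht].
rewrite -/(var _ (floor_sign (x :: s) :: y :: t)) size_floor_supp_cons floor_sign_cons.
have {}IH := IH t hs ht.
move: x01 hy; rewrite !inE => /orP[]/eqP->; rewrite ?eqxx ?oner_eq0 /=.
  rewrite orbb -[X in (X <= _)%N]/(var _ (-1 :: y :: t)) => hy.
  (* For [x = 0] the entry [y] is [-1] or 0, hence invisible after [-1]. *)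
  have -> : var _ (-1 :: y :: t) = var _ (-1 :: t).
    by case/orP: hy => /eqP-> /=; rewrite ?mul0r ?ltxx.
  move: IH; rewrite /floor_sign; case: odd => IH; last exact: IH.
  rewrite add1n; apply: leq_trans (var_cons_le _ _ (1 : int) _) _.
  exact: IH.
rewrite -[X in (X <= _)%N]/(var _ (- floor_sign s :: y :: t)).
have [z zE z1] : exists2 z, floor_sign s = z & z \in [:: -1; 1].
  by exists (floor_sign s) => //; rewrite /floor_sign; case: odd.
move: IH; rewrite zE => IH hy.
have [e|e] := eqVneq y z.
  rewrite e var_cons_opp ?add1n //.
  by move: z1; rewrite !inE => /orP[]/eqP->.
(* Now [y] is [- z] or 0, hence absorbed by the prefixed [- z]. *)
apply: leq_trans (_ : var _ (- z :: t) <= _)%N; last first.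
  by rewrite add1n; apply: leq_trans (var_cons_le _ _ z _) _.
by move: z1 hy e; rewrite !inE => /orP[]/eqP-> /or3P[]/eqP-> //=; rewrite ?mul0r.
Qed.

(** Built downwards from a [-1] just past the end of [s]: support entries alternate in sign, and a
    zero entry becomes [-1] exactly below a run of odd length. *)
Lemma var_floor_attained s : sign01 s -> exists2 t, compat s t &
  first_nonzero _ t = floor_sign s /\ var _ t = size (floor_supp s).
Proof.
elim: s => [_|x s IH] /=; first by exists [:: -1].
move=> /andP[x01 /IH[t ht [ft vt]]].
rewrite size_floor_supp_cons floor_sign_cons.
move: x01; rewrite !inE => /orP[]/eqP->; rewrite ?eqxx ?oner_eq0 /=.
  case: (boolP (odd _)) => o.
    exists (-1 :: t); first by rewrite compat_cons ht.
    by rewrite /= ft vt /floor_sign o.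
  exists (0 :: t); first by rewrite compat_cons ht.
  by rewrite /= ft vt mul0r /floor_sign (negbTE o).
exists (- floor_sign s :: t).
  by rewrite compat_cons ht /floor_sign; case: odd.
by rewrite /= ft vt /floor_sign; case: odd.
Qed.

Lemma dfrak_size_floor s n : sign01 s -> dfrak_eq s n -> size (floor_supp s) = n.
Proof.
move=> hs [ub [t [ht tn]]]; apply/eqP; rewrite eqn_leq; apply/andP; split.
  have [u hu [_ <-]] := var_floor_attained s hs.
  by rewrite -SC_sgz (compat_sgz hs hu) ub.
rewrite -tn -(compat_sgz hs ht) SC_sgz.
exact: leq_trans (var_consW _ _ _) (var_floor_ub _ _ hs ht).
Qed.

(** Each interval away from position 0 is completed to an even number of elements, so only the run
    at 0 affects the parity. *)
Lemma odd_size_floor s : odd (size (floor_supp s)) = odd (run_len s 0).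
Proof.
elim: s => // x s IH; rewrite size_floor_supp_cons run_len_cons oddD IH.
by case: (x =P 0) => _ /=; case: (odd (run_len s 0)).
Qed.

(** The index [j] is 0-based, so even [j] means odd rank. An element added by the floor has an odd
    number of elements above it, by [odd_size_floor]. *)
Lemma floor_supp_from_top s j : (j < size (floor_supp s))%N -> ~~ odd j ->
  s`_(nth 0%N (rev (floor_supp s)) j) != 0.
Proof.
elim: s => [//|x s IH] in j *.
rewrite floor_supp_cons rev_cat size_cat size_map in_floor0 -map_rev nth_cat.
rewrite size_map size_rev; case: (ltnP j (size (floor_supp s))) => hj.
  by move=> _ oj; rewrite (nth_map 0%N) ?size_rev //=; exact: IH.
case: (boolP (_ || _)) => //= h hj2 oj; last by lia.
have ej : j = size (floor_supp s) by lia.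
rewrite ej subnn /=; move: h oj; rewrite ej odd_size_floor.
by case: odd; rewrite ?orbF.
Qed.

Lemma sorted_floor_supp s : sorted ltn (floor_supp s).
Proof. by apply: sorted_filter (iota_ltn_sorted _ _); exact: ltn_trans. Qed.

Lemma mem_floor_supp s i : s`_i != 0 -> i \in floor_supp s.
Proof.
move=> h; rewrite mem_filter mem_iota add0n /= /in_floor h /=.
by rewrite ltnNge; apply: contra h => h; rewrite nth_default.
Qed.

(** Converts a wrong sign at [x] into an extra root, to be refuted by Descartes' rule. *)
Lemma root_beyond (R : rcfType) (p : {poly R}) (x : R) :
  0 < lead_coef p -> p.[x] <= 0 -> exists2 y, x <= y & root p y.
Proof.
move=> lp px; have [z zP] := polyrcf.poly_pinfty_gt_lc lp.
have xz : x <= Num.max x z by rewrite le_max lexx.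
have pz : p.[x] <= 0 <= p.[Num.max x z].
  rewrite px; apply: ltW; apply: lt_le_trans lp _; apply: zP.
  by rewrite le_max lexx orbT.
by have [y /andP[xy _] ry] := poly_ivt xz pz; exists y.
Qed.

Section SparsePoly.
Variables (R : realDomainType) (n : nat) (e : 'I_n -> nat) (c : 'I_n -> R).

Definition sparse_poly : {poly R} := \sum_j c j *: 'X^(e j).

Lemma horner_sparse x : sparse_poly.[x] = \sum_j c j * x ^+ e j.
Proof. by rewrite horner_sum; apply: eq_bigr => j _; rewrite !hornerE. Qed.

Lemma coef_sparse k : sparse_poly`_k = \sum_(j | e j == k) c j.
Proof.
rewrite coef_sum [RHS]big_mkcond; apply: eq_bigr => j _.
by rewrite coefZ coefXn eq_sym; case: eqP; rewrite ?mulr1 ?mulr0.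
Qed.

Lemma var_sparse : (var R sparse_poly <= n.-1)%N.
Proof.
apply: leq_trans (var_le_count _ _) _; rewrite -!subn1 leq_sub2r //.
rewrite -[sparse_poly : seq R](mkseq_nth 0) /mkseq count_map -size_filter.
rewrite -[X in (_ <= X)%N](size_enum_ord n) -(size_map e); apply: uniq_leq_size.
  by rewrite filter_uniq ?iota_uniq.
move=> k; rewrite mem_filter /= => /andP[hk _]; apply: contraR hk => hk.
rewrite ?negbK coef_sparse big1 // => j /eqP ej.
by rewrite -ej map_f ?mem_enum in hk.
Qed.

End SparsePoly.

(** * Positivity of generalized Vandermonde determinants *)

Section GeneralizedVandermonde.
Variable R : rcfType.

Definition gvdm (n : nat) (x : 'I_n -> R) (e : 'I_n -> nat) : 'M[R]_n :=
  \matrix_(i, j) x i ^+ e j.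

Lemma lift_homo n (h : 'I_n.+1) : {homo lift h : i j / (i < j)%N}.
Proof. by move=> i j; rewrite /= /bump; lia. Qed.

Lemma minor_gvdm n (x : 'I_n.+1 -> R) e r c :
  row' r (col' c (gvdm n.+1 x e)) = gvdm n (x \o lift r) (e \o lift c).
Proof. by apply/matrixP => i j; rewrite !mxE. Qed.

(** As a function of its last node the determinant is a polynomial [P] with [n.+1] monomials,
    vanishing at the [n] earlier nodes, with a smaller such determinant as leading coefficient. A
    value [<= 0] at the last node would give one positive root too many. *)
Lemma gvdm_det_gt0 n (x : 'I_n -> R) (e : 'I_n -> nat) :
  (forall i, 0 < x i) -> {homo x : i j / (i < j)%N >-> i < j} ->
  {homo e : i j / (i < j)%N} -> 0 < \det (gvdm n x e).
Proof.
elim: n x e => [|n IH] x e x0 hx he; first by rewrite det_mx00.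
set A := gvdm _ _ _; pose P := sparse_poly R n.+1 e (fun j => cofactor A ord_max j).
have detE : P.[x ord_max] = \det A.
  rewrite horner_sparse (expand_det_row _ ord_max).
  by apply: eq_bigr => j _; rewrite mxE mulrC.
have rootP i : root P (x (lift ord_max i)).
  rewrite rootE horner_sparse.
  (* The value of [P] at an earlier node is a determinant with two equal rows. *)
  pose B := \matrix_(r, s) (if r == ord_max then x (lift ord_max i) ^+ e s else A r s).
  have detB : \det B = 0.
    apply: (@determinant_alternate _ _ _ ord_max (lift ord_max i)).
      exact: neq_lift.
    by move=> j; rewrite !mxE eqxx eq_sym (negbTE (neq_lift _ _)).
  apply/eqP; rewrite -[RHS]detB (expand_det_row _ ord_max); apply: eq_bigr => j _.
  rewrite mxE eqxx mulrC; congr (_ * (_ * \det _)).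
  by apply/matrixP => r s; rewrite !mxE eq_sym (negbTE (neq_lift _ _)).
have e_inj : injective e.
  move=> i j eij; apply: val_inj => /=.
  by case: (ltngtP i j) => // /he; rewrite eij ltnn.
have coefP : P`_(e ord_max) = \det (gvdm n (x \o lift ord_max) (e \o lift ord_max)).
  rewrite coef_sparse (big_pred1 ord_max) => [|j]; last by rewrite /= (inj_eq e_inj).
  by rewrite /cofactor addnn -signr_odd odd_double expr0 mul1r minor_gvdm.
have cP : 0 < P`_(e ord_max).
  rewrite coefP; apply: IH => [i|i j ij|i j ij] /=; first exact: x0.
  - by apply: hx; apply: lift_homo.
  - by apply: he; apply: lift_homo.
have szP : size P = (e ord_max).+1.
  apply/eqP; rewrite eqn_leq; apply/andP; split; last first.
    by apply: contraTT cP; rewrite -leqNgt => h; rewrite nth_default ?ltxx.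
  apply/leq_sizeP => k hk; rewrite coef_sparse big_pred0 // => j.
  apply/negbTE; apply: contraTneq hk => <-; rewrite -leqNgt.
  have [->//|jm] := eqVneq j ord_max; apply/ltnW/he.
  by rewrite ltn_neqAle jm -ltnS ltn_ord.
have lP : 0 < lead_coef P by rewrite lead_coefE szP.
rewrite -detE ltNge; apply/negP => /(root_beyond _ _ _ lP)[y xy ry].
have P0 : P != 0 by rewrite -lead_coef_eq0 gt_eqF.
have lt_max i : x (lift ord_max i) < x ord_max.
  by apply: hx; rewrite lift_max.
have x_inj : injective x.
  move=> i j eij; apply: val_inj => /=.
  by case: (ltngtP i j) => // /hx; rewrite eij ltxx.
have := @descartes R P (y :: [seq x (lift ord_max i) | i <- enum 'I_n]) P0.
rewrite /= size_map size_enum_ord => H.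
have : (n.+1 <= n)%N; last by rewrite ltnn.
apply: leq_trans (H _ _) (var_sparse R n.+1 e _).
- apply/andP; split.
    apply/mapP => -[i _ yi]; have := lt_max i.
    by rewrite -yi ltNge xy.
  by rewrite map_inj_uniq ?enum_uniq // => i j /x_inj /lift_inj.
- rewrite ry (lt_le_trans (x0 _) xy) /=; apply/allP => _ /mapP[i _ ->].
  by rewrite x0 rootP.
Qed.

Lemma gvdm_minor_gt0 n (x : 'I_n.+1 -> R) (e : 'I_n.+1 -> nat) r c :
  (forall i, 0 < x i) -> {homo x : i j / (i < j)%N >-> i < j} ->
  {homo e : i j / (i < j)%N} -> 0 < \det (row' r (col' c (gvdm n.+1 x e))).
Proof.
move=> x0 hx he; rewrite minor_gvdm; apply: gvdm_det_gt0 => [i|i j ij|i j ij] /=.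
- exact: x0.
- by apply: hx; apply: lift_homo.
- by apply: he; apply: lift_homo.
Qed.

End GeneralizedVandermonde.

(** * Cramer's rule for a right-hand side perturbed in one coordinate *)

Section ReplaceColumn.
Variables (R : comNzRingType) (n : nat).
Implicit Types (A : 'M[R]_n) (u v : 'cV[R]_n) (c : 'I_n).

Definition setcol A c v : 'M[R]_n :=
  \matrix_(i, j) (if j == c then v i 0 else A i j).

Lemma det_setcol A c v : \det (setcol A c v) = (\adj A *m v) c 0.
Proof.
rewrite (expand_det_col _ c) mxE; apply: eq_bigr => i _.
rewrite !mxE eqxx mulrC; congr (_ * _ * _); congr (\det _).
apply/matrixP => r s; rewrite !mxE ifN //.
by rewrite eq_sym neq_lift.
Qed.

Lemma det_setcol_perturb A c u r (t : R) :
  \det (setcol A c (A *m u + t *: delta_mx r 0)) =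
  u c 0 * \det A + t * cofactor A r c.
Proof.
rewrite det_setcol mulmxDr mulmxA mul_adj_mx mul_scalar_mx -scalemxAr.
rewrite !mxE mulrC (bigD1 r) //= !mxE !eqxx mulr1 big1 ?addr0 // => i ir.
by rewrite !mxE (negbTE ir) mulr0.
Qed.

End ReplaceColumn.

(** Clears the logarithms in the condition on [k]; [ln (z / y)] is positive because [y < z]. *)
Lemma expr_le_of_ln (R : realType) (k : nat) (p q y z : R) :
  0 < p -> 0 < q -> 0 < y -> y < z ->
  ln (p / q) / ln (z / y) <= k%:R -> p * y ^+ k <= q * z ^+ k.
Proof.
move=> p0 q0 y0 yz; have z0 : 0 < z by apply: lt_trans yz.
have zy1 : 1 < z / y by rewrite ltr_pdivlMr // mul1r.
have zy0 : 0 < z / y by apply: lt_trans zy1.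
rewrite ler_pdivrMr ?ln_gt0 // mulr_natl -lnXn // ler_ln ?posrE ?divr_gt0 ?exprn_gt0 //.
by rewrite ler_pdivrMr // expr_div_n mulrAC ler_pdivlMr ?exprn_gt0 // [z ^+ k * q]mulrC.
Qed.

Lemma sign01_Sign (R : realDomainType) (f : {poly R}) :
  nonneg_poly f -> sign01 (Sign f).
Proof.
move=> hf; apply/(all_nthP 0) => i _; rewrite nth_Sign !inE.
by case: (ltrgtP 0 f`_i) (hf i) => // [/gtr0_sgz->|<-]; rewrite ?sgz0.
Qed.

Lemma increasing_ltn (R : realDomainType) (a : nat -> R) (n : nat) :
  (forall i, (1 <= i <= n)%N -> a i < a i.+1) ->
  forall i j, (1 <= i)%N -> (i < j)%N -> (j <= n.+1)%N -> a i < a j.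
Proof.
move=> h i j i1; elim: j => // j IH; rewrite ltnS leq_eqVlt => /orP[/eqP<-|ij] jn.
  by apply: h; rewrite i1.
apply: lt_trans (h j _); first by apply: IH => //; lia.
by lia.
Qed.

(** * The exponents [d_j], read in increasing order *)

Section Exponents.
Variables (s : seq int) (n : nat).
Hypothesis size_s : size (floor_supp s) = n.

Lemma dseq_from_bottom (c : nat) : (c < n)%N ->
  dseq s (n - c) = nth 0%N (floor_supp s) c.
Proof.
move=> cn; rewrite /dseq nth_rev size_s; last by lia.
by congr nth; lia.
Qed.

Lemma dseq_homo (c c' : nat) : (c < c')%N -> (c' < n)%N ->
  (dseq s (n - c) < dseq s (n - c'))%N.
Proof.
move=> cc c'n; rewrite !dseq_from_bottom //; last exact: ltn_trans c'n.
have := sorted_ltn_nth ltn_trans 0%N (sorted_floor_supp s).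
by apply=> //; rewrite inE size_s //; exact: ltn_trans c'n.
Qed.

(** The floor only enlarges the support; the added exponents carry coefficient 0. *)
Lemma sparse_of_floor_supp (R : realDomainType) (f : {poly R}) : s = Sign f ->
  f = sparse_poly R n (fun c => dseq s (n - c)) (fun c => f`_(dseq s (n - c))).
Proof.
move=> sf; apply/polyP => k; rewrite coef_sparse.
have [fk|fk] := eqVneq f`_k 0.
  by rewrite fk big1 // => c /eqP->.
have kin : k \in floor_supp s by apply: mem_floor_supp; rewrite sf nth_Sign sgz_eq0.
have kn : (index k (floor_supp s) < n)%N by rewrite -size_s index_mem.
rewrite (big_pred1 (Ordinal kn)) => [|c].
  by rewrite dseq_from_bottom //= nth_index.
rewrite dseq_from_bottom //= -[RHS]val_eqE /=; apply/eqP/eqP => [<-|->].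
  by rewrite index_uniq ?size_s // filter_uniq ?iota_uniq.
by rewrite nth_index.
Qed.

End Exponents.

(** * Positivity of the determinants [D], with [n = m.+1] *)

Section Main.
Variables (R : realType) (m : nat) (a b : nat -> R) (f f0 : {poly R}).
Hypothesis a_gt0 : forall i : nat, (1 <= i <= m.+2)%N -> 0 < a i.
Hypothesis a_lt : forall i : nat, (1 <= i <= m.+1)%N -> a i < a i.+1.
Hypothesis f_min : is_minpoly m.+2 a b f.
Hypothesis f0_min : is_minpoly m.+1 a b f0.
Hypothesis f0_dfrak : dfrak_eq (Sign f0) m.+1.
Hypothesis f0f : f0 != f.

Let d := dseq (Sign f0).
Let D := Dji m.+1 a b d.
Let delta := b m.+2 - f0.[a m.+2].
Let node (r : 'I_m.+2) := a r.+1.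

Let node_gt0 r : 0 < node r.
Proof. by apply: a_gt0; rewrite /= ltn_ord. Qed.

Let node_homo : {homo node : i j / (i < j)%N >-> i < j}.
Proof. by move=> i j ij; apply: increasing_ltn a_lt _ _ _ _ _ => //; rewrite ltn_ord. Qed.

Lemma size_floor : size (floor_supp (Sign f0)) = m.+1.
Proof. by apply: dfrak_size_floor f0_dfrak; apply: sign01_Sign; case: f0_min. Qed.

(** The [m.+1] common values exhaust the bound for [f0], so [f - f0] has positive leading
    coefficient. If it were [<= 0] at the last node, a further common value would lie at or beyond
    that node. *)
Lemma delta_gt0 : 0 < delta.
Proof.
case: f_min f0_min f0_dfrak => f_ge0 fb _ [f0_ge0 f0b _] [f0d _].
pose rs := [seq a i | i <- iota 1 m.+1].
have urs : uniq rs.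
  rewrite map_inj_in_uniq ?iota_uniq // => i j; rewrite !mem_iota => hi hj aij.
  case: (ltngtP i j) => // h.
    have : a i < a j by apply: (increasing_ltn _ _ _ a_lt) => //; lia.
    by rewrite aij ltxx.
  have : a j < a i by apply: (increasing_ltn _ _ _ a_lt) => //; lia.
  by rewrite aij ltxx.
have hrs : all (fun x => (0 < x) && (f0.[x] == f.[x])) rs.
  apply/allP => x /mapP[i]; rewrite mem_iota => hi ->.
  by rewrite a_gt0 ?f0b ?fb ?eqxx //; lia.
have srs : size rs = m.+1 by rewrite size_map size_iota.
have := common_values_bound R f0 f m.+1 rs f0_ge0 f_ge0 f0d f0f urs hrs.
rewrite srs; case: ltrP => lead; first by rewrite add1n ltnn.
move=> _.
have nz : f - f0 != 0 by rewrite subr_eq0 eq_sym.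
have lead' : 0 < lead_coef (f - f0).
  by rewrite lt_neqAle eq_sym lead_coef_eq0 nz -opprB lead_coefN oppr_ge0.
rewrite ltNge; apply/negP => dle.
have : (f - f0).[a m.+2] <= 0 by rewrite hornerD hornerN fb // !ltnSn.
move=> /(root_beyond _ _ _ lead')[y ay ry].
have yrs : y \notin rs.
  apply/mapP => -[i]; rewrite mem_iota => hi yi; move: ay; rewrite yi leNgt.
  by rewrite (increasing_ltn _ _ _ a_lt) //; lia.
have y0 : 0 < y by apply: lt_le_trans ay; apply: a_gt0; rewrite leqnn.
have fy : f0.[y] == f.[y].
  by move: ry; rewrite rootE hornerD hornerN subr_eq0 eq_sym.
have := common_values_bound R f0 f m.+1 (y :: rs) f0_ge0 f_ge0 f0d f0f.
rewrite cons_uniq yrs urs [all _ (_ :: _)]/(_ && all _ rs) y0 fy hrs => /(_ isT isT).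
have szy : size (y :: rs) = m.+2 by rewrite -srs.
rewrite szy => H.
have : (m.+2 <= m.+1)%N; last by rewrite ltnn.
by apply: leq_trans H; exact: leq_addl.
Qed.

Let b_node (r : 'I_m.+2) : b r.+1 = f0.[node r] + (r == ord_max)%:R * delta.
Proof.
case: f0_min => _ f0b _; have [->|rm] := eqVneq r ord_max.
  by rewrite mul1r /delta /node /= addrC subrK.
rewrite mul0r addr0 f0b //= ltnS; have := ltn_ord r; move: rm; rewrite -val_eqE /=; lia.
Qed.

Let expo (c : 'I_m.+1) := d (m.+1 - c).

Let expo_homo : {homo expo : i j / (i < j)%N}.
Proof. by move=> i j ij; apply: dseq_homo size_floor _ _ ij (ltn_ord _). Qed.

Let f0_node r : f0.[node r] = \sum_c f0`_(expo c) * node r ^+ expo c.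
Proof.
rewrite {1}(sparse_of_floor_supp _ _ size_floor _ _ (erefl _)).
by rewrite horner_sparse.
Qed.

Lemma f0_coef_odd (c : 'I_m.+1) : odd (m.+1 - c) -> 0 < f0`_(expo c).
Proof.
move=> oc; case: f0_min => f0_ge0 _ _; rewrite lt_neqAle f0_ge0 andbT eq_sym.
rewrite -sgz_eq0 -nth_Sign; apply: floor_supp_from_top.
  by rewrite size_floor; have := ltn_ord c; lia.
by move: oc; have := ltn_ord c; lia.
Qed.

(** The column [b] consists of the values of [f0], corrected by [delta] in the last row; the
    correction disappears when that row is the deleted one. *)
Lemma row'_Delta (i : 'I_m.+2) (c : 'I_m.+1) :
  row' i (Delta m.+1 a b d (m.+1 - c)) =
  setcol _ _ (gvdm _ _ (node \o lift i) expo) c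
    (gvdm _ _ (node \o lift i) expo *m (\col_c' f0`_(expo c'))
     + ((i != ord_max)%:R * delta) *: delta_mx ord_max 0).
Proof.
apply/matrixP => r s; rewrite !mxE.
have -> : (s == (m.+1 - (m.+1 - c))%N :> nat) = (s == c).
  by rewrite subKn // ltnW.
case: (s == c) => //; rewrite b_node f0_node; congr (_ + _).
  by apply: eq_bigr => c' _; rewrite !mxE mulrC.
rewrite eqxx andbT mulrAC [RHS]mulrC mulrC; congr (_ * _).
have [->|im] := eqVneq i ord_max.
  by rewrite eq_sym (negbTE (neq_lift _ _)) mul0r.
rewrite mul1r; congr (nat_of_bool _)%:R.
rewrite -!val_eqE /= /bump; have := ltn_ord i; have := ltn_ord r.
by move: im; rewrite -val_eqE /=; lia.
Qed.

Lemma Dji_gt0 (i : 'I_m.+2) (c : 'I_m.+1) : odd (m.+1 - c) ->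
  0 < D (m.+1 - c) i.+1.
Proof.
move=> oc; rewrite /D /Dji inord_val row'_Delta det_setcol_perturb mxE.
have lh := lift_homo _ i.
have n0 r : 0 < (node \o lift i) r by exact: node_gt0.
have nh : {homo node \o lift i : i j / (i < j)%N >-> i < j}.
  by move=> r s rs; apply: node_homo; apply: lh.
apply: ltr_wpDr; last first.
  by rewrite mulr_gt0 ?f0_coef_odd // gvdm_det_gt0.
apply: mulr_ge0; first by rewrite mulr_ge0 ?ler0n ?(ltW delta_gt0).
rewrite /cofactor -signr_odd.
(* The last row has index [m], and [m + c] is even since [m.+1 - c] is odd. *)
have -> : odd ((ord_max : 'I_m.+1) + c) = false.
  by move: oc; have := ltn_ord c; rewrite /=; lia.
by rewrite expr0 mul1r ltW // gvdm_minor_gt0.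
Qed.

(** * The interpolant [h] and the degree bound *)

Section DegreeBound.
Variable k : nat.
Hypothesis dk : (d 1 < k)%N.
Hypothesis Dk : forall j i : nat, (1 <= j <= m.+1)%N -> odd j ->
  (1 <= i <= m.+1)%N -> m.+1%:R * D j i * a i ^+ k <= D j m.+2 * a m.+2 ^+ k.

Let expo_k (c : 'I_m.+2) := if (c < m.+1)%N then d (m.+1 - c) else k.

Let expo_k_homo : {homo expo_k : i j / (i < j)%N}.
Proof.
move=> i j ij; rewrite /expo_k; have := ltn_ord j; rewrite ltnS leq_eqVlt.
have im : (i < m.+1)%N by exact: leq_trans ij (ltn_ord j).
rewrite im => /orP[/eqP->|jm].
  rewrite ltnn; apply: leq_trans dk; rewrite ltnS.
  have [e|/negbTE e] := eqVneq (i : nat) m; first by rewrite e subSnn.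
  have := dseq_homo _ _ size_floor i m; rewrite subSnn -/d => H.
  by apply/ltnW/H => //; lia.
by rewrite jm; apply: dseq_homo size_floor _ _ ij jm.
Qed.

Let V := gvdm _ _ node expo_k.
Let u0 : 'cV[R]_m.+2 := \col_c if (c < m.+1)%N then f0`_(expo_k c) else 0.
Let bvec : 'cV[R]_m.+2 := \col_r b r.+1.
Let u : 'cV[R]_m.+2 := (\det V)^-1 *: (\adj V *m bvec).
Let h := sparse_poly R m.+2 expo_k (fun c => u c 0).

Let V_gt0 : 0 < \det V.
Proof. exact: gvdm_det_gt0. Qed.

Let bvecE : bvec = V *m u0 + delta *: delta_mx ord_max 0.
Proof.
apply/matrixP => r c; rewrite !mxE ord1 b_node f0_node eqxx andbT [_ * delta]mulrC.
congr (_ + _); rewrite [RHS]big_ord_recr /= !mxE ltnn mulr0 addr0.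
by apply: eq_bigr => i _; rewrite !mxE /expo_k /= ltn_ord mulrC.
Qed.

Let V_u : V *m u = bvec.
Proof.
by rewrite -scalemxAr mulmxA mul_mx_adj mul_scalar_mx scalerA mulVf ?scale1r ?gt_eqF.
Qed.

Let h_node r : h.[node r] = b r.+1.
Proof.
rewrite horner_sparse; have := congr1 (fun A : 'cV_m.+2 => A r 0) V_u.
by rewrite !mxE => <-; apply: eq_bigr => c _; rewrite [V r c]mxE mulrC.
Qed.

(** This includes the column of ['X^k], where [c = m.+1]. The cofactor multiplying [delta] has sign
    [+]. *)
Let u_even (c : 'I_m.+2) : ~~ odd (m.+1 + c) -> 0 <= u c 0.
Proof.
move=> ec; rewrite mxE mulr_ge0 ?invr_ge0 ?(ltW V_gt0) //.
rewrite -det_setcol bvecE det_setcol_perturb addr_ge0 // mulr_ge0 ?(ltW V_gt0) ?(ltW delta_gt0) //.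
  by rewrite mxE; case: ifP => // _; case: f0_min.
by rewrite /cofactor -signr_odd (negbTE ec) expr0 mul1r ltW // gvdm_minor_gt0.
Qed.

Let minor_setcol (c : 'I_m.+1) i :
  \det (row' i (col' ord_max (setcol _ _ V (lift ord_max c) bvec))) =
  D (m.+1 - c) i.+1.
Proof.
rewrite /D /Dji inord_val; congr (\det _); apply/matrixP => r s; rewrite !mxE.
rewrite (inj_eq lift_inj) subKn; last by rewrite ltnW.
by rewrite /expo_k lift_max ltn_ord.
Qed.

Let u_odd (c : 'I_m.+2) : odd (m.+1 + c) -> 0 <= u c 0.
Proof.
move=> oc; rewrite mxE mulr_ge0 ?invr_ge0 ?(ltW V_gt0) // -det_setcol.
have [c'|cm] := unliftP ord_max c; last by move: oc; rewrite cm /=; lia.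
move=> ec; rewrite ec (expand_det_col _ ord_max).
have c'm : (c' < m.+1)%N := ltn_ord c'.
have oc' : odd (m.+1 - c').
  by move: oc; rewrite ec lift_max oddD oddB ?(ltnW c'm) //=.
set j := (m.+1 - c')%N in oc'.
have j_range : (1 <= j <= m.+1)%N by rewrite /j; lia.
under eq_bigr => i _.
  rewrite [X in X * _]mxE (negbTE (neq_lift _ _)) [V _ _]mxE /expo_k ltnn.
  rewrite /cofactor minor_setcol -/j; over.
rewrite big_ord_recr /=.
set T := D j m.+2 * a m.+2 ^+ k.
have -> : node ord_max ^+ k * ((-1) ^+ (m.+1 + m.+1) * D j m.+2) = T.
  by rewrite -signr_odd addnn odd_double expr0 mul1r mulrC.
have N0 : 0 < m.+1%:R :> R by rewrite ltr0n.
(* The last term is shared equally among the other rows, whence the factor [m.+1%:R] in [Dk]. *)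
have -> : T = \sum_(i < m.+1) T / m.+1%:R.
  by rewrite sumr_const card_ord -[RHS]mulr_natr divfK // gt_eqF.
rewrite -big_split sumr_ge0 //= => i _.
set i' := widen_ord _ i; rewrite -lerBlDr sub0r.
have Di : 0 < D j i.+1 by exact: (Dji_gt0 i' c').
have xi := node_gt0 i'.
set y := _ * (_ * _).
have ny : `|y| = D j i.+1 * a i.+1 ^+ k.
  rewrite /y !normrM !normrX normrN1 expr1n mul1r !gtr0_norm //.
  by rewrite mulrC.
(* The alternating sign of [y] is discarded; its absolute value is bounded by one share. *)
apply: le_trans (_ : - `|y| <= _); last by rewrite lerNl -normrN ler_norm.
rewrite lerN2 ny ler_pdivlMr // mulrC mulrA; apply: Dk => //.
by rewrite /= ltn_ord.
Qed.

Let h_ge0 : nonneg_poly h.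
Proof.
move=> i; rewrite coef_sparse sumr_ge0 // => c _.
by case: (boolP (odd (m.+1 + c))); [exact: u_odd | exact: u_even].
Qed.

Let size_h : (size h <= k.+1)%N.
Proof.
apply/leq_sizeP => i ki; rewrite coef_sparse big_pred0 // => c; apply/negbTE.
apply: contraTneq ki => <-; rewrite -leqNgt.
have -> : k = expo_k ord_max by rewrite /expo_k ltnn.
have [->//|cm] := eqVneq c ord_max; apply/ltnW/expo_k_homo.
by rewrite ltn_neqAle cm -ltnS ltn_ord.
Qed.

(** Otherwise [f - h] has the positive leading coefficient of [f], and the [m.+2] common values
    exceed the bound for [f] by one. *)
Lemma size_minpoly_le : (size f <= k.+1)%N.
Proof.
case: f_min => f_ge0 fb f_dfrak.
have [<-//|fh] := eqVneq h f.
rewrite leqNgt; apply/negP => kf.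
have hf : (size (- h) < size f)%N by rewrite size_polyN (leq_ltn_trans size_h).
have lead : 0 < lead_coef (f - h).
  rewrite lead_coefDl // lt_neqAle lead_coefE f_ge0 andbT eq_sym -lead_coefE.
  by rewrite lead_coef_eq0 -size_poly_gt0 (leq_trans _ kf).
have := common_values_bound R f h m.+2 [seq node r | r <- enum 'I_m.+2] f_ge0 h_ge0 f_dfrak.
rewrite eq_sym fh lead size_map size_enum_ord add1n ltnn => H.
suff : false by []; apply: H => //.
  rewrite map_inj_uniq ?enum_uniq // => i j eij; apply: val_inj => /=.
  by case: (ltngtP i j) => // /node_homo; rewrite eij ltxx.
by apply/allP => x /mapP[r _ ->]; rewrite node_gt0 h_node /node fb ?eqxx //=.
Qed.

End DegreeBound.
End Main.

Theorem mainTheorem7 (R : realType) (n : nat) (a b : nat -> R)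
    (f f0 : {poly R}) :
  (1 <= n)%N ->
  (forall i : nat, (1 <= i <= n.+1)%N -> 0 < a i) ->
  (forall i : nat, (1 <= i <= n.+1)%N -> 0 <= b i) ->
  (forall i : nat, (1 <= i <= n)%N -> a i < a i.+1) ->
  is_minpoly n.+1 a b f ->
  is_minpoly n a b f0 ->
  dfrak_eq (Sign f0) n ->
  f0 != f ->
  let d := dseq (Sign f0) in
  let D := Dji n a b d in
  size (floor_supp (Sign f0)) = n /\
  (forall j i : nat, (1 <= j <= n)%N -> odd j -> (1 <= i <= n.+1)%N ->
     0 < D j i) /\
  (forall k : nat,
     let P := fun k : nat =>
       (d 1%N < k)%N /\
       (forall j i : nat, (1 <= j <= n)%N -> odd j -> (1 <= i <= n)%N ->
          ln (n%:R * D j i / D j n.+1) / ln (a n.+1 / a i) <= k%:R) in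
     P k -> (forall k' : nat, (k' < k)%N -> ~ P k') ->
     ((size f).-1 <= k)%N).
Proof.
case: n => [//|m] _ a_gt0 _ a_lt f_min f0_min f0_dfrak f0f d D.
have D_gt0 j i : (1 <= j <= m.+1)%N -> odd j -> (1 <= i <= m.+2)%N -> 0 < D j i.
  case: i => // i /andP[j0 jm] oj /= im.
  (* The exponent [d_j] sits in the 0-based column [m.+1 - j]. *)
  have cm : (m.+1 - j < m.+1)%N by lia.
  have := Dji_gt0 _ _ _ _ _ _ a_gt0 a_lt f_min f0_min f0_dfrak f0f (Ordinal im) (Ordinal cm).
  by rewrite /= subKn //; apply.
split; first exact: size_floor f0_min f0_dfrak.
split=> // k P [dk Pk] _; rewrite -subn1 leq_subLR add1n.
apply: (size_minpoly_le _ _ _ _ _ _ a_gt0 a_lt f_min f0_min f0_dfrak f0f k dk).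
move=> j i hj oj hi; rewrite -/d -/D.
apply: expr_le_of_ln (Pk j i hj oj hi).
- by rewrite mulr_gt0 ?ltr0n // D_gt0 //; lia.
- by rewrite D_gt0 // ltnSn.
- by apply: a_gt0; lia.
- by apply: (increasing_ltn _ _ _ a_lt) => //; lia.
Qed.
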